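(* Let $k,l\ge 2$ be integers and let $X\subset\mathcal{C}_k$ be an ideal of colorings (with $l$ colors). Then either there exist constants $c$ and $n_0$ such that $|X_n|=c$ for every $n>n_0$, or $|X_n|\ge n-k+2$ for every $n\in\mathbb{N}$.
   Context: $\mathbb{N}=\{1,2,\dots\}$ and $[n]=\{1,2,\dots,n\}$; $\binom{A}{k}$ is the set of $k$-element subsets of $A$. For fixed integers $k,l\ge2$, a coloring is a pair $(n,\chi)$ with $n\in\mathbb{N}$ and $\chi:\binom{[n]}{k}\to[l]$ any map (for $n<k$ the map $\chi$ is the empty map); $\mathcal{C}_k$ is the set of all colorings. For colorings, $(m,\phi)\preceq(n,\chi)$ means that there is an increasing injection $f:[m]\to[n]$ such that $\phi(E)=\chi(f(E))$ for every $E\in\binom{[m]}{k}$. A set $X\subset\mathcal{C}_k$ is an ideal if $K\preceq L\in X$ implies $K\in X$. $X_n$ is the set of those colorings in $X$ that have the vertex set $[n]$. *)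

(* Defs.v *)
From mathcomp Require Import all_boot all_order all_algebra.
From mathcomp Require Import boolp classical_sets.

Set Implicit Arguments.
Unset Strict Implicit.
Unset Printing Implicit Defensive.

(* The vertex set [n] = {1, ..., n} is represented by 'I_n = {0, ..., n - 1}
   with its usual order, and the color set [l] by 'I_l. *)

Definition ksubset (k n : nat) := {E : {set 'I_n} | #|E| == k}.

Lemma card_imset_ksubset (k m n : nat) (f : 'I_m -> 'I_n)
  (f_inj : injective f) (E : ksubset k m) : #|f @: val E| == k.
Proof. by rewrite card_imset // (valP E). Qed.

Definition ksubset_image (k m n : nat) (f : 'I_m -> 'I_n)
    (f_inj : injective f) (E : ksubset k m) : ksubset k n :=
  exist _ (f @: val E) (card_imset_ksubset f_inj E).

Record coloring (k l : nat) := Coloring {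
  order : nat;
  order_gt0 : 0 < order;
  color : {ffun ksubset k order -> 'I_l}
}.

Definition contained (k l : nat) (K L : coloring k l) : Prop :=
  exists (f : 'I_(order K) -> 'I_(order L)) (f_inj : injective f),
    {homo f : i j / i < j} /\
    forall E : ksubset k (order K),
      color K E = color L (ksubset_image f_inj E).

Definition ideal (k l : nat) (X : set (coloring k l)) : Prop :=
  forall K L : coloring k l, contained K L -> X L -> X K.

(* X_n. A coloring with vertex set [n] is identified with its color map, so
   that X_n is a subset of a finite type; it is empty for n = 0, because
   colorings have at least one vertex. *)
Definition level (k l : nat) (X : set (coloring k l)) (n : nat) :
    {set {ffun ksubset k n -> 'I_l}} :=
  [set chi | `[< exists n_gt0 : 0 < n, X (Coloring n_gt0 chi) >]].

(* Main.v *)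
(* Call a coloring of [n] r-tame if no edge changes color when one of its
   vertices v is moved to v + 1, as long as both keep distance r from the ends
   of [n]. If some r works for all colorings in X, then deleting the vertex r is
   an injection from X_{n+1} to X_n for large n, so |X_n| is eventually
   constant.

   Otherwise, for arbitrarily large r, X contains a coloring in which the edges
   S + {v} and S + {v + 1} have different colors. By pigeonhole S = A + B' + C,
   where v lies among B' and there are long gaps between A and B' + {v} and
   between B' + {v} and C. Ramsey's theorem turns the left gap into a long
   sequence L such that all edges A + T + C with T in L of size h = |B'| + 1
   have one color a. For w = v or w = v + 1 the edge A + (B' + {w}) + C is not
   of color a. Let W be L, then B' + {w}, then part of the right gap. The colors
   u_p of A + (p-th window of length h in W) + C form a word that starts with
   N = n - k + 1 letters a and is not constant, hence it has N + 1 different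
   factors of length N: the first letter other than a is at any of N positions
   or absent. Restrictions of the coloring to A + (interval of W) + C realize
   them by different elements of X_n. *)

Require Import Defs.
From mathcomp Require Import all_boot all_order all_algebra.
From mathcomp Require Import boolp classical_sets.
From mathcomp Require Import zify.

Set Implicit Arguments.
Unset Strict Implicit.
Unset Printing Implicit Defensive.

(** * Counting lemmas and Ramsey's theorem for sequences *)

Lemma eventually_constant (u : nat -> nat) (n0 : nat) :
  (forall n, n0 <= n -> u n.+1 <= u n) ->
  exists c n1, forall n, n1 < n -> u n = c.
Proof.
(* Induction on a bound for [u n0]: a strict drop restarts the argument with a smaller bound. *)
elim: {n0}(u n0) {-2}n0 (leqnn (u n0)) => [|b IHb] n0 ub u_dec.
  exists 0, n0 => n; elim: n => // n IHn lt_n.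
  have le_n : n0 <= n by [].
  have : u n = 0.
    by move: le_n; rewrite leq_eqVlt => /orP[/eqP<-|/IHn//]; lia.
  by have := u_dec n le_n; lia.
have [[n1 le_n1 lt_u]|u_const] :=
    pselect (exists2 n1, n0 <= n1 & u n1.+1 < u n0).
  apply: (IHb n1.+1) => [|n le_n]; first lia.
  by apply: u_dec; lia.
exists (u n0), n0 => n; case: n => // n le_n.
have le_u : forall i, u (n0 + i) <= u n0.
  elim=> [|i IHi]; first by rewrite addn0.
  by rewrite addnS; apply: leq_trans IHi; apply: u_dec; lia.
apply/eqP; rewrite eqn_leq; apply/andP; split.
  by have := le_u (n.+1 - n0); rewrite subnKC //; lia.
by rewrite leqNgt; apply/negP => lt_u; apply: u_const; exists n.
Qed.

(** A relation replaces a map because restrictions of colorings come only as existence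
    statements. *)
Lemma leq_card_rel (S T : finType) (A : {set S}) (B : {set T})
    (r : S -> T -> Prop) :
  (forall x, x \in A -> exists2 y, y \in B & r x y) ->
  (forall x x' y, x \in A -> x' \in A -> r x y -> r x' y -> x = x') ->
  #|A| <= #|B|.
Proof.
move=> r_tot r_inj; pose g x := [pick y in B | `[< r x y >]].
have gP x : x \in A -> exists2 y, g x = Some y & y \in B /\ r x y.
  move=> /r_tot[y yB rxy]; rewrite /g; case: pickP => [z /andP[zB /asboolP]|].
    by exists z.
  by move=> /(_ y); rewrite yB /=; move/asboolP: rxy => ->.
rewrite -(card_in_imset (f := g)).
  have some_inj : injective (@Some T) by move=> y y' [].
  rewrite -(card_imset (mem B) some_inj); apply: subset_leq_card.
  apply/fintype.subsetP.
  by move=> _ /imsetP[x /gP[y -> [yB _]] ->]; apply: imset_f.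
move=> x x' xA x'A; have [y -> [_ rxy]] := gP x xA.
by have [y' -> [_ rxy']] := gP x' x'A; case=> yy'; apply: r_inj rxy _; rewrite ?yy'.
Qed.

Lemma pigeonhole_seq (I : Type) (T : finType) (c : I -> T) (s : seq I) (m : nat) :
  0 < m -> #|T| * m <= size s -> 0 < #|T| ->
  exists a, m <= count (fun x => c x == a) s.
Proof.
move=> m_gt0 le_s T_gt0; apply: contrapT => no_a.
have {}no_a a : count (fun x => c x == a) s <= m.-1.
  rewrite leqNgt; apply/negP => lt_a; apply: no_a; exists a; lia.
have : size s = \sum_(a : T) count (fun x => c x == a) s.
  elim: s {le_s no_a} => [|x s IHs] /=; first by rewrite big1.
  by rewrite big_split -IHs /= (bigD1 (c x)) //= eqxx big1 ?addn0 // => a;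
    rewrite eq_sym => /negPf->.
have : \sum_(a : T) count (fun x => c x == a) s <= \sum_(a : T) m.-1.
  by apply: leq_sum.
rewrite sum_nat_const => le_sum eq_sum; rewrite -eq_sum in le_sum.
by have := leq_trans le_s le_sum; rewrite leq_pmul2l //; lia.
Qed.

(** Induction on [k]: thin out [s] until the color of a tuple of size [k.+1] depends only on its
    first entry, then keep [m] entries with a common color. *)
Lemma ramsey (T : finType) (k m : nat) (T_gt0 : 0 < #|T|) :
  exists G, forall (I : eqType) (chi : seq I -> T) (s : seq I),
    uniq s -> G <= size s ->
    exists (L : seq I) (a : T), [/\ subseq L s, size L = m &
      forall t, subseq t L -> size t = k -> chi t = a].
Proof.
elim: k m => [|k IHk] m.
  exists m => I chi s _ le_m; exists (take m s), (chi [::]).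
  split; [exact: take_subseq | exact: size_takel |].
  by move=> t _ /size0nil->.
have T0 : T := enum_val (Ordinal T_gt0).
have [G GP] : exists G, forall (I : eqType) (chi : seq I -> T) (s : seq I),
    uniq s -> G <= size s ->
    exists (L : seq I) (c : I -> T), [/\ subseq L s, size L = #|T| * m &
      forall x t, subseq (x :: t) L -> size t = k -> chi (x :: t) = c x].
  elim: (#|T| * m) => [|p [G GP]].
    exists 0 => I chi s _ _; exists [::], (fun=> T0).
    by split=> //; exact: sub0seq.
  have [G' G'P] := IHk G; exists G'.+1 => I chi [//|x s] /= /andP[xs us] le_s.
  have [L1 [a [L1s sL1 L1P]]] := G'P I (fun t => chi (x :: t)) s us le_s.
  have uL1 : uniq L1 by exact: subseq_uniq us.
  have [//|L [c [LL1 sL LP]]] := GP I chi L1 uL1; first by rewrite sL1.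
  have xL : x \notin L.
    by apply: contra xs => /(mem_subseq LL1)/(mem_subseq L1s).
  exists (x :: L), (fun y => if y == x then a else c y); split.
  - by rewrite /= eqxx (subseq_trans LL1).
  - by rewrite /= sL.
  move=> y t /=; case: eqP => [-> tL|_ ytL] st.
    by apply: L1P => //; apply: subseq_trans LL1.
  exact: LP.
exists G => I chi s us le_s; have [L [c [Ls sL LP]]] := GP I chi s us le_s.
have [->|m_gt0] := posnP m.
  by exists [::], T0; split=> //; [exact: sub0seq | case].
have [|a le_a] := @pigeonhole_seq _ _ c L m m_gt0 _ T_gt0.
  by rewrite sL.
exists (take m [seq x <- L | c x == a]), a; split.
- apply: subseq_trans (take_subseq _ _) _.
  by apply: subseq_trans Ls; exact: filter_subseq.
- by rewrite size_takel // size_filter.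
case=> // x t sub_t [st].
have {}sub_t := subseq_trans sub_t (take_subseq _ _).
rewrite (LP x t) //; last by apply: subseq_trans sub_t _; exact: filter_subseq.
have : x \in [seq x <- L | c x == a].
  by apply: mem_subseq sub_t _ _; rewrite mem_head.
by rewrite mem_filter => /andP[/eqP].
Qed.

(** * Increasing lists of numbers: splitting, runs and gaps *)

(* Strictly increasing sequences in [lo, hi); requiring lo <= hi even for the
   empty sequence makes adjacent blocks concatenate (block_cat). *)
Fixpoint block (lo hi : nat) (s : seq nat) : bool :=
  if s is x :: s' then (lo <= x) && block x.+1 hi s' else lo <= hi.

Lemma block_leq (lo hi : nat) (s : seq nat) : block lo hi s -> lo <= hi.
Proof. by elim: s lo => //= x s IHs lo /andP[le_x /IHs]; lia. Qed.

Lemma blockE (lo hi : nat) (s : seq nat) :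
  block lo hi s =
    [&& lo <= hi, sorted ltn s & all (fun z => lo <= z < hi) s].
Proof.
elim: s lo => [|x s IHs] lo /=; first by rewrite !andbT.
rewrite IHs (path_sortedE ltn_trans); apply/idP/idP.
  case/and4P=> le_x lt_x s_lt s_in; apply/and3P; split; first lia.
    by rewrite s_lt andbT; apply: sub_all s_in => z /=; lia.
  by apply/andP; split; [lia | apply: sub_all s_in => z /=; lia].
case/and4P=> le_lohi /andP[lt_s s_lt] le_x s_in.
apply/and4P; split; [lia | lia | by [] |].
apply/allP => z zs; move: (allP lt_s z zs) (allP s_in z zs) => /=; lia.
Qed.

Lemma block_widen (lo hi lo' hi' : nat) (s : seq nat) :
  lo' <= lo -> hi <= hi' -> block lo hi s -> block lo' hi' s.
Proof.
elim: s lo lo' => [|x s IHs] lo lo' /= le_lo le_hi; first lia.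
by case/andP=> le_x s_b; rewrite (leq_trans le_lo le_x) (IHs x.+1).
Qed.

Lemma block_cat (lo x hi : nat) (s1 s2 : seq nat) :
  block lo x s1 -> block x hi s2 -> block lo hi (s1 ++ s2).
Proof.
elim: s1 lo => [|y s1 IHs] lo /=.
  by move=> le_lo s2_b; apply: block_widen s2_b.
by case/andP=> -> s1_b s2_b; exact: IHs.
Qed.

Lemma block_catW (lo x hi : nat) (s1 s2 : seq nat) :
  block lo hi (s1 ++ x :: s2) -> block lo x s1 /\ block x.+1 hi s2.
Proof.
elim: s1 lo => [|y s1 IHs] lo /=; first by move/andP.
by case/andP=> -> /IHs.
Qed.

Lemma block_split (lo x hi : nat) (s : seq nat) :
  lo <= x -> x <= hi -> block lo hi s ->
  exists s1 s2, [/\ s = s1 ++ s2, block lo x s1 & block x hi s2].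
Proof.
elim: s lo => [|y s IHs] lo /= le_lo le_hi; first by exists [::], [::].
case/andP=> le_y s_b; have [lt_yx|le_xy] := ltnP y x.
  have [s1 [s2 [-> s1_b s2_b]]] := IHs _ lt_yx le_hi s_b.
  by exists (y :: s1), s2; rewrite /= le_y.
by exists [::], (y :: s); rewrite /= le_xy.
Qed.

Lemma block_subseq (lo hi : nat) (s t : seq nat) :
  subseq t s -> block lo hi s -> block lo hi t.
Proof.
elim: s lo t => [|x s IHs] lo [|y t] //=.
  by move=> _ /andP[le_x /block_leq]; lia.
move=> t_s /andP[le_x s_b]; move: t_s; case: eqP => [-> t_s|_ t_s].
  by rewrite le_x IHs.
by apply: (@block_widen x.+1 hi lo hi (y :: t)) => //; [lia | exact: IHs].
Qed.

Lemma block_iota (x j : nat) : block x (x + j) (iota x j).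
Proof. by elim: j x => [|j IHj] x /=; rewrite ?addn0 // leqnn addnS -addSn IHj. Qed.

(** The run from [lo] is maximal: [lo + j] is skipped, and the size bound leaves room for it below
    [hi]. *)
Lemma block_run (lo hi : nat) (s : seq nat) :
  block lo hi s -> lo + size s < hi ->
  exists j s', s = iota lo j ++ s' /\ block (lo + j).+1 hi s'.
Proof.
elim: s lo => [|x s IHs] lo /=; first by exists 0, [::]; split=> //=; lia.
case/andP=> le_x s_b lt_hi; have [eq_x|lt_x] := eqVneq x lo.
  rewrite eq_x in s_b *; have [|j [s' [-> s'_b]]] := IHs _ s_b; first lia.
  by exists j.+1, s'; rewrite addnS -addSn.
by exists 0, (x :: s); split=> //=; rewrite s_b; lia.
Qed.

(** Each gap that is too short, together with the point that ends it, uses up at most [G] of the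
    length. *)
Lemma block_gap (G lo hi : nat) (s : seq nat) :
  block lo hi s -> lo + (size s).+1 * G <= hi ->
  exists (s1 s2 : seq nat) (x : nat),
    [/\ s = s1 ++ s2, block lo x s1 & block (x + G) hi s2].
Proof.
elim: s lo => [|p s IHs] lo /=.
  by move=> _; rewrite mul1n; exists [::], [::], lo; rewrite /= leqnn.
case/andP=> le_p s_b le_hi; have [le_G|lt_G] := leqP (lo + G) p.
  by exists [::], (p :: s), lo; split=> //=; rewrite le_G.
have [|s1 [s2 [x [-> s1_b s2_b]]]] := IHs _ s_b.
  by rewrite mulSn in le_hi; lia.
by exists (p :: s1), s2, x; rewrite /= le_p.
Qed.

Definition kseq (k n : nat) (s : seq nat) : bool :=
  [&& sorted ltn s, all (gtn n) s & size s == k].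

Lemma kseqE (k n : nat) (s : seq nat) :
  kseq k n s = block 0 n s && (size s == k).
Proof. by rewrite blockE /= -andbA. Qed.

(** * Colors of vertex lists, restrictions and tame colorings *)

Section Eval.
Variables (k l : nat).

(* The color of the vertex set listed by [s], and [None] unless [s] lists an
   edge. *)
Definition eval (n : nat) (chi : {ffun ksubset k n -> 'I_l}) (s : seq nat) :
    option 'I_l :=
  omap chi (insub [set i : 'I_n | val i \in s]).

Lemma sorted_ksubset (n : nat) (E : ksubset k n) :
  kseq k n [seq val i | i <- enum (val E)].
Proof.
apply/and3P; split.
- rewrite sorted_map; apply: (subseq_sorted (leT := fun x y : 'I_n => x < y)).
  + by move=> x y z; exact: ltn_trans.
  + have -> : enum (val E) = [seq i <- enum 'I_n | i \in val E].
      by rewrite [enum 'I_n]enumT.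
    exact: filter_subseq.
  by have := iota_ltn_sorted 0 n; rewrite -val_enum_ord sorted_map.
- by apply/allP => _ /mapP[i _ ->] /=.
by rewrite size_map -cardE (valP E).
Qed.

Lemma eval_ksubset (n : nat) (chi : {ffun ksubset k n -> 'I_l})
    (E : ksubset k n) : eval chi [seq val i | i <- enum (val E)] = Some (chi E).
Proof.
rewrite /eval; set F := [set i | _].
have -> : F = val E.
  by apply/setP => i; rewrite inE (mem_map val_inj) mem_enum.
by rewrite valK.
Qed.

Lemma eval_inj (n : nat) (chi chi' : {ffun ksubset k n -> 'I_l}) :
  (forall s, kseq k n s -> eval chi s = eval chi' s) -> chi = chi'.
Proof.
move=> eq_chi; apply/ffunP => E; apply: ssrfun.Some_inj.
by rewrite -!eval_ksubset; apply: eq_chi; exact: sorted_ksubset.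
Qed.

(** All later arguments use the ideal property through this lemma. [f] lives on [nat] so that it can
    be [bump r] or [nth 0 V]. *)
Lemma level_restrict (X : set (coloring k l)) (m n : nat) (f : nat -> nat)
    (chi : {ffun ksubset k n -> 'I_l}) :
  ideal X -> 0 < m -> (forall i j, i < j -> j < m -> f i < f j) ->
  (forall i, i < m -> f i < n) -> chi \in level X n ->
  exists2 phi, phi \in level X m &
    forall s, kseq k m s -> eval phi s = eval chi [seq f i | i <- s].
Proof.
move=> hX m_gt0 f_homo f_lt; rewrite inE => /asboolP[n_gt0 Xchi].
pose g (i : 'I_m) : 'I_n := Ordinal (f_lt i (ltn_ord i)).
have g_homo : {homo g : i j / i < j} by move=> i j /= ?; exact: f_homo.
have g_inj : injective g.
  move=> i j /(congr1 val) /= fij; apply: val_inj => /=.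
  by case: (ltngtP i j) => // ij; have := f_homo _ _ ij (ltn_ord _);
    rewrite fij ltnn.
exists [ffun E : ksubset k m => chi (ksubset_image g_inj E)].
  rewrite inE; apply/asboolP; exists m_gt0; apply: hX Xchi.
  by exists g, g_inj; split=> // E /=; rewrite ffunE.
move=> s /and3P[s_sorted s_lt /eqP s_size]; rewrite /eval.
set F := [set i : 'I_m | _].
have mF : [seq val i | i <- pmap (insub : nat -> option 'I_m) s] = s.
  rewrite (pmap_filter (insubK 'I_m)); apply/all_filterP.
  by apply: sub_all s_lt => i /= lt_i; rewrite insubT.
have us : uniq s by exact: sorted_uniq ltn_trans ltnn s s_sorted.
have FE : F =i pmap insub s.
  by move=> i; rewrite inE -{1}mF (mem_map val_inj).
have cF : #|F| == k.
  rewrite (eq_card FE); have /card_uniqP -> : uniq (pmap insub s : seq 'I_m).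
    by rewrite -(map_inj_uniq val_inj) mF.
  by rewrite -(size_map val) mF s_size.
have -> : [set i : 'I_n | val i \in [seq f i | i <- s]] = g @: F.
  apply/setP => i; rewrite inE; apply/mapP/imsetP => [[j js fj]|[j jF ->]].
    exists (Ordinal (allP s_lt _ js)); first by rewrite inE.
    exact: val_inj.
  by exists (val j) => //; move: jF; rewrite inE.
rewrite (insubT (fun E : {set 'I_m} => #|E| == k) cF) /= ffunE.
have cF' : #|g @: F| == k by rewrite card_imset.
rewrite (insubT (fun E : {set 'I_n} => #|E| == k) cF') /=; congr (Some (chi _)).
exact: val_inj.
Qed.

Definition tame (r n : nat) (chi : {ffun ksubset k n -> 'I_l}) : Prop :=
  forall s1 v s2, kseq k n (s1 ++ v :: s2) -> kseq k n (s1 ++ v.+1 :: s2) ->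
    r <= v -> v.+1 + r < n ->
    eval chi (s1 ++ v :: s2) = eval chi (s1 ++ v.+1 :: s2).

(** The top vertex of the run moves first, so every intermediate list is still strictly
    increasing. *)
Lemma tame_shift (r n : nat) (chi : {ffun ksubset k n -> 'I_l})
    (s1 s2 : seq nat) (v j : nat) :
  tame r chi -> block 0 v s1 -> block (v + j).+1 n s2 ->
  size s1 + j + size s2 = k -> r <= v -> v + j + r < n ->
  eval chi (s1 ++ iota v j ++ s2) = eval chi (s1 ++ iota v.+1 j ++ s2).
Proof.
move=> tame_chi s1_b; elim: j s2 => [|j IHj] s2 s2_b sz le_v lt_n //.
rewrite -[j.+1]addn1 !iotaD -!catA /= ?addSn.
have v_b := block_cat s1_b (block_iota v j).
rewrite addnS in s2_b lt_n.
have s2'_b : block (v + j).+1 n ((v + j).+1 :: s2) by rewrite /= leqnn.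
rewrite -(IHj _ s2'_b) //=; [|lia..].
rewrite catA [in RHS]catA; apply: tame_chi; [| |lia..].
  rewrite kseqE size_cat /= size_cat size_iota.
  apply/andP; split; last by apply/eqP; lia.
  apply: (block_cat v_b) => /=; rewrite leqnn /=.
  by apply: block_widen s2_b; lia.
rewrite kseqE size_cat /= size_cat size_iota.
apply/andP; split; last by apply/eqP; lia.
by apply: (block_cat v_b) => /=; rewrite leqnSn.
Qed.

(* An edge through r is moved off r by shifting by one the maximal run of
   consecutive vertices that starts at r. *)
Lemma leq_card_level_tame (X : set (coloring k l)) (r n : nat) :
  ideal X -> 2 * r + k < n ->
  (forall chi : {ffun ksubset k n.+1 -> 'I_l}, chi \in level X n.+1 ->
     tame r chi) ->
  #|level X n.+1| <= #|level X n|.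
Proof.
move=> hX lt_n tame_X.
(* The relation says that deleting the vertex [r] from [chi] leaves [phi]. *)
apply: (@leq_card_rel _ _ _ _ (fun chi phi => forall s, kseq k n s ->
  eval phi s = eval chi [seq bump r i | i <- s])) => [chi chiX|].
  by apply: level_restrict hX _ _ _ chiX => [|i j|i]; rewrite ?/bump; lia.
move=> chi chi' phi chiX chi'X phi_chi phi_chi'; apply: eval_inj => s.
rewrite kseqE => /andP[s_b /eqP sz_s].
have [||s1 [s2 [eq_s s1_b s2_b]]] := block_split (x := r) _ _ s_b; [lia|lia|].
have [|j [s3 [eq_s2 s3_b]]] := block_run s2_b.
  by rewrite eq_s size_cat in sz_s; lia.
have sz : size s1 + j + size s3 = k.
  by rewrite -sz_s eq_s eq_s2 !size_cat size_iota addnA.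
rewrite eq_s eq_s2.
have shift psi (psiX : psi \in level X n.+1) :=
  @tame_shift _ _ psi _ _ _ _ (tame_X psi psiX) s1_b s3_b sz (leqnn r).
rewrite !shift //; [|lia..].
(* The shifted edge avoids [r], so it is the image of [s'] under [bump r] and [phi] determines its
   color. *)
pose s' := s1 ++ iota r j ++ [seq i.-1 | i <- s3].
have -> : s1 ++ iota r.+1 j ++ s3 = [seq bump r i | i <- s'].
  rewrite !map_cat; congr (_ ++ (_ ++ _)).
  - rewrite -[LHS]map_id; apply/eq_in_map => i.
    move: s1_b; rewrite blockE => /and3P[_ _ /allP s1_b] /s1_b.
    by rewrite /bump; lia.
  - rewrite -[r.+1]addn1 addnC iotaDl; apply/eq_in_map => i.
    by rewrite mem_iota /bump; lia.
  rewrite -map_comp -[LHS]map_id; apply/eq_in_map => i.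
  move: s3_b; rewrite blockE => /and3P[_ _ /allP s3_b] /s3_b.
  by rewrite /= /bump; lia.
have kseq_s' : kseq k n s'.
  rewrite kseqE !size_cat size_iota size_map addnA sz eqxx andbT.
  apply: (block_cat s1_b); apply: (block_cat (block_iota r j)).
  move: s3_b; elim: s3 (r + j) {eq_s2 sz s' shift} => [|x s3 IHs] lo //=.
  case/andP=> lt_x s3_b; apply/andP; split; first lia.
  by apply: IHs; rewrite prednK //; lia.
by rewrite -phi_chi // -phi_chi'.
Qed.

End Eval.

(** * Many restrictions of colorings that are not tame *)

Lemma map_nth_window (T : Type) (x0 : T) (s1 s2 s3 : seq T) (i j : nat) :
  i + j <= size s2 ->
  [seq nth x0 (s1 ++ s2 ++ s3) p | p <-
     iota 0 (size s1) ++ iota (size s1 + i) j ++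
     iota (size s1 + size s2) (size s3)] =
  s1 ++ take j (drop i s2) ++ s3.
Proof.
move=> le_ij; rewrite !map_cat !map_nth_iota ?size_cat; try lia.
rewrite drop0 take_size_cat //; congr (_ ++ (_ ++ _)).
  rewrite addnC -drop_drop drop_size_cat // drop_cat; case: ltnP => lt_i.
    by rewrite takel_cat // size_drop; lia.
  have -> : j = 0 by lia.
  by rewrite !take0.
by rewrite addnC -drop_drop !drop_size_cat // take_size.
Qed.

(** An interval of [W] of length [m] contains [N] windows of length [h]. The first letter of [u]
    other than [a] has position at most [m], so [m + m <= size W] leaves room for all intervals
    needed. *)
Lemma card_level_window (k l : nat) (X : set (coloring k l)) (n M : nat)
    (chi : {ffun ksubset k M -> 'I_l}) (A W C : seq nat) (N h m : nat)
    (a : option 'I_l) (u := fun p => eval chi (A ++ take h (drop p W) ++ C)) :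
  ideal X -> 0 < n -> chi \in level X M -> block 0 M (A ++ W ++ C) ->
  size A + h + size C = k -> size A + m + size C = n -> m.+1 = N + h ->
  m + m <= size W -> (forall q, q < N -> u q = a) -> u m <> a ->
  N < #|level X n|.
Proof.
move=> hX n_gt0 chiX AWC_b sz_k sz_n sz_m sz_W u_N /eqP u_m.
have [p u_p p_min] := ex_minnP (ex_intro (fun p => u p != a) m u_m).
have le_Np : N <= p by rewrite leqNgt; apply: contra u_p => /u_N ->.
have le_pm := p_min m u_m.
have u_lt q : q < p -> u q = a.
  by move=> lt_q; apply/eqP; apply: contraTT lt_q => /p_min; rewrite leqNgt.
(* After relabeling by [[n]], the [q]-th window gives the edge [t q], whichever interval of [W] was
   chosen. *)
pose t q := iota 0 (size A) ++ iota (size A + q) h ++ iota (size A + m) (size C).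
have t_k q : q < N -> kseq k n (t q).
  move=> lt_q; rewrite kseqE !size_cat !size_iota addnA sz_k eqxx andbT.
  apply: block_cat (block_iota 0 (size A)) _.
  apply: (@block_cat _ (size A + m)).
    by apply: block_widen (block_iota _ h); lia.
  by apply: block_widen (block_iota _ (size C)); lia.
have <- : #|[set: 'I_N.+1]| = N.+1 by rewrite cardsT card_ord.
(* The factor of length N of u starting at p - j has its first letter other
   than a in place j (none for j = N). *)
apply: (@leq_card_rel _ _ _ _ (fun (j : 'I_N.+1) phi => forall q, q < N ->
  eval phi (t q) = u (p - j + q))) => [j _|].
  have lt_j : j <= N by rewrite -ltnS.
  pose D := take m (drop (p - j) W).
  have sz_D : size D = m by rewrite size_takel // size_drop; lia.
  pose V := A ++ D ++ C.
  have sz_V : size V = n by rewrite 2!size_cat sz_D addnA.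
  have V_b : block 0 M V.
    apply: block_subseq AWC_b; apply: cat_subseq => //; apply: cat_subseq => //.
    exact: subseq_trans (take_subseq _ _) (drop_subseq _ _).
  move: V_b; rewrite blockE => /and3P[_ V_sorted /allP V_lt].
  have [||phi phiX phi_eq] := level_restrict (f := nth 0 V) hX n_gt0 _ _ chiX.
  - move=> i i' lt_i lt_i'; apply: (sorted_ltn_nth ltn_trans 0 V_sorted) => //.
      by rewrite inE sz_V; apply: ltn_trans lt_i'.
    by rewrite inE sz_V.
  - by move=> i lt_i; apply: V_lt; rewrite mem_nth ?sz_V.
  exists phi => // q lt_q; rewrite phi_eq ?t_k //.
  rewrite /t -sz_D map_nth_window; last by rewrite sz_D; lia.
  rewrite /u /D; congr (eval chi (_ ++ _ ++ _)).
  have -> : m = (m - q) + q by lia.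
  rewrite -take_drop drop_drop take_takel ?[q + _]addnC //; lia.
(* At [q = j] the index [j] sees [u p], which is not [a], while [j'] sees a letter before position
   [p]. *)
have lt_contra (j j' : 'I_N.+1) (phi : {ffun ksubset k n -> 'I_l}) : j < j' ->
    (forall q, q < N -> eval phi (t q) = u (p - j + q)) ->
    (forall q, q < N -> eval phi (t q) = u (p - j' + q)) -> False.
  have := ltn_ord j'; rewrite ltnS => le_j' lt_j phi_j phi_j'.
  have lt_jN : j < N by lia.
  move: (phi_j' _ lt_jN); rewrite phi_j // subnK; last by lia.
  by rewrite (u_lt (p - j' + j)); [apply/eqP | lia].
move=> j j' phi _ _ phi_j phi_j'; apply: val_inj.
by case: (ltngtP j j') => // lt_j; case: (lt_contra _ _ phi lt_j).
Qed.

Lemma card_level_wild (k l : nat) (X : set (coloring k l)) (n : nat) :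
  ideal X -> 0 < n ->
  (forall r, exists M, exists2 chi : {ffun ksubset k M -> 'I_l},
     chi \in level X M & ~ tame r chi) ->
  n.+2 <= #|level X n| + k.
Proof.
move=> hX n_gt0 wild.
(* For [n < k] one element of the level suffices. A coloring that is not [n]-tame has more than [n]
   vertices and restricts to one. *)
have [lt_nk|le_kn] := ltnP n k.
  have [M [chi chiX Nt]] := wild n.
  have lt_nM : n < M.
    rewrite ltnNge; apply/negP => le_Mn; apply: Nt => s1 v s2 _ _; lia.
  have [||phi phiX _] := level_restrict (f := id) hX n_gt0 _ _ chiX.
  - by [].
  - by move=> i lt_i; lia.
  have : 0 < #|level X n| by apply/card_gt0P; exists phi.
  lia.
have [N eq_N] : exists N, N + k = n.+1 by exists (n.+1 - k); lia.
suff : N < #|level X n| by lia.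
have card_T : 0 < #|{: option 'I_l}| by rewrite card_option.
have [G0 G0P] := choice (fun j => ramsey j (N + j).-1 card_T).
(* The size [h] of the middle block is known only after [G] is fixed, so [G] must serve all sizes up
   to [k]. [N + k <= G] lets the right gap supply [m] vertices. *)
have [G leNG leG0] : exists2 G, N + k <= G & forall j, j <= k -> G0 j <= G.
  exists (N + k + \max_(j < k.+1) G0 j) => [|j]; first exact: leq_addr.
  rewrite -ltnS => lt_j; apply: leq_trans (leq_addl _ _).
  by rewrite (bigD1 (Ordinal lt_j)) //= leq_maxl.
have [M [chi chiX]] := wild (k.+1 * G).
case/boolp.existsNP=> s1 /boolp.existsNP[v] /boolp.existsNP[s2].
case/boolp.not_implyP=> v_k /boolp.not_implyP[v'_k].
case/boolp.not_implyP=> le_v /boolp.not_implyP[lt_M neq_v].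
move: v_k v'_k; rewrite !kseqE !size_cat /=.
move=> /andP[/block_catW[s1_b _] /eqP sz] /andP[/block_catW[_ s2_b] _].
have [|A [B1 [x [eq_s1 A_b B1_b]]]] := block_gap (G := G) s1_b.
  rewrite add0n; apply: leq_trans le_v.
  by rewrite leq_mul2r; apply/orP; right; lia.
have [|B2 [C [y [eq_s2 B2_b C_b]]]] := block_gap (G := G) s2_b.
  have : (size s2).+1 * G <= k.+1 * G.
    by rewrite leq_mul2r; apply/orP; right; lia.
  by lia.
have [h eq_h] : exists h, size B1 + (size B2).+1 = h by eexists.
have sz_k : size A + h + size C = k.
  by move: sz; rewrite eq_s1 eq_s2 !size_cat -eq_h; clear; lia.
have h_gt0 : 0 < h by rewrite -eq_h addnS.
have [m eq_m] : exists m, m.+1 = N + h by exists (N + h).-1; lia.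
have [||L [a [L_s]]] :=
    G0P h _ (fun t => eval chi (A ++ t ++ C)) (iota x G).
- exact: iota_uniq.
- by rewrite size_iota leG0 // -sz_k addnAC leq_addl.
rewrite -eq_m /= => sz_L L_a.
have L_b := block_subseq L_s (block_iota x G).
have [w w_v w_a] : exists2 w, w = v \/ w = v.+1 &
    eval chi (A ++ (B1 ++ w :: B2) ++ C) <> a.
  have [eq_a|neq_a] := pselect (eval chi (A ++ (B1 ++ v :: B2) ++ C) = a).
    exists v.+1; first by right.
    move: neq_v eq_a; rewrite eq_s1 eq_s2 -!catA /= => neq_v eq_a eq_v.
    by apply: neq_v; rewrite eq_a.
  by exists v; first left.
have [B eq_B sz_B] : exists2 B, B = B1 ++ w :: B2 & size B = h.
  by exists (B1 ++ w :: B2); rewrite // size_cat.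
have B_b : block (x + G) y B.
  rewrite eq_B; apply: block_cat B1_b _ => /=; apply/andP; split.
    by clear -w_v; lia.
  by apply: block_widen B2_b => //; clear -w_v; lia.
have le_mG : m <= G by clear -eq_m leNG sz_k; lia.
(* The first [N] windows lie inside [L], the window at position [m = size L] is [B], and [iota y m]
   makes [W] long enough. *)
apply: (@card_level_window _ _ _ _ _ chi A (L ++ B ++ iota y m) C N h m a) => //.
- apply: (block_cat A_b); apply: block_cat C_b; apply: (block_cat L_b).
  apply: (block_cat B_b); apply: block_widen (block_iota y m) => //.
  by rewrite leq_add2l.
- by clear -sz_k eq_m eq_N; lia.
- by rewrite !size_cat size_iota sz_L; clear; lia.
- move=> q lt_q; have le_q : q + h <= m by clear -lt_q eq_m; lia.
  rewrite drop_cat sz_L ifT; last by clear -le_q h_gt0; lia.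
  have le_h : h <= size (drop q L) by rewrite size_drop sz_L; clear -le_q; lia.
  rewrite takel_cat //; apply: L_a; last by rewrite size_takel.
  exact: subseq_trans (take_subseq _ _) (drop_subseq _ _).
by rewrite drop_size_cat // take_size_cat // eq_B.
Qed.

Theorem theorem1p1 (k l : nat) (hk : 2 <= k) (hl : 2 <= l)
    (X : set (coloring k l)) (hX : ideal X) :
  (exists c n0 : nat, forall n : nat, n0 < n -> #|level X n| = c) \/
  (forall n : nat, 0 < n ->
     (n%:Z - k%:Z + 2%:Z <= #|level X n|%:Z)%R).
Proof.
have [[r tame_X]|wild] := pselect (exists r, forall n
    (chi : {ffun ksubset k n -> 'I_l}), chi \in level X n -> tame r chi).
  left; apply: (@eventually_constant (fun n => #|level X n|) (2 * r + k).+1).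
  by move=> n lt_n; apply: (@leq_card_level_tame _ _ _ r) => //; exact: tame_X.
right=> n n_gt0; suff: n.+2 <= #|level X n| + k by lia.
apply: card_level_wild => // r; apply: contrapT => no_wild; apply: wild.
exists r => M chi chiX.
by apply: contrapT => Nt; apply: no_wild; exists M, chi.
Qed.
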